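(* Let $\mathscr{A} = (Q,\Sigma,\delta)$ be an aperiodically $1$-contracting DFA with $n$ states. Suppose there exists an efficient $1$-contracting collection $W\subseteq \Sigma^\star$ for which the induced state map $\sigma_W$ is a cyclic permutation on $Q$. Then: (1) the shortest synchronizing word of $\mathscr{A}$ has length at most $(n-1)^2$; (2) for every nonempty set $S\subseteq Q$ of size $k$, there exists a word $w_S$ of length at most $n(n-k)$ such that $\delta(Q,w_S)=S$.
   Context: A DFA is $\mathscr{A}=(Q,\Sigma,\delta)$ with finite state set $Q$, finite alphabet $\Sigma$ and transition function $\delta:Q\times\Sigma\to Q$, extended to $Q\times\Sigma^\star$ in the usual way, and to subsets by $\delta(S,w)=\{\delta(q,w)\mid q\in S\}$. A word $w$ is synchronizing if $\delta(Q,w)$ is a singleton. For $q\in Q$, $w\in\Sigma^\star$, $\delta^{-1}(q,w)=\{p\in Q\mid\delta(p,w)=q\}$. A word $w$ is a $1$-deficient word excluding $q$ if $\delta(Q,w)=Q\setminus\{q\}$; it then has exactly one state $q^c$ with $|\delta^{-1}(q^c,w)|=2$, its contracting state. A collection $W\subseteq\Sigma^\star$ is a $1$-contracting collection if for every $q\in Q$ it contains exactly one $1$-deficient word excluding $q$; it is efficient if moreover $|w|\le n$ for all $w\in W$. $\mathscr{A}$ is $1$-contracting if a $1$-contracting collection exists. The state map $\sigma_W:Q\to Q$ sends $q$ to the contracting state of the unique word of $W$ excluding $q$. $\mathscr{A}$ is aperiodically $1$-contracting if there is a $1$-contracting collection $W$ with $\sigma_W$ a cyclic permutation of $Q$ (a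 single $n$-cycle). *)

(* Defs.v *)
From mathcomp Require Import classical_sets.
From mathcomp Require Import all_boot fingroup perm.

Set Implicit Arguments.
Unset Strict Implicit.
Unset Printing Implicit Defensive.

Local Open Scope nat_scope.

Section Automata.

Variables (Q Sigma : finType) (delta : Q -> Sigma -> Q).

Definition run (q : Q) (w : seq Sigma) : Q := foldl delta q w.

Definition run_set (S : {set Q}) (w : seq Sigma) : {set Q} :=
  [set run q w | q in S].

Definition run_preim (q : Q) (w : seq Sigma) : {set Q} :=
  [set p | run p w == q].

Definition synchronizing (w : seq Sigma) : Prop :=
  exists q : Q, run_set [set: Q] w = [set q].

Definition shortest_synchronizing (w : seq Sigma) : Prop :=
  synchronizing w /\ forall v, synchronizing v -> size w <= size v.

Definition one_deficient (w : seq Sigma) (q : Q) : Prop :=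
  run_set [set: Q] w = [set: Q] :\ q.

(* A collection may also contain words that are not 1-deficient. *)
Definition one_contracting_collection (W : set (seq Sigma)) : Prop :=
  forall q : Q, exists! w, W w /\ one_deficient w q.

Definition efficient_collection (W : set (seq Sigma)) : Prop :=
  one_contracting_collection W /\ forall w, W w -> size w <= #|Q|.

(* The contracting state of a 1-deficient word is its only state with exactly
   two preimages; on other words, [q0] may be returned. *)
Definition contracting_state (q0 : Q) (w : seq Sigma) : Q :=
  odflt q0 [pick c | #|run_preim c w| == 2].

(* The default values [[::]] and [q] are irrelevant when [W] is a 1-contracting
   collection: both choices are then uniquely determined. *)
Definition excluding_word (W : set (seq Sigma)) (q : Q) : seq Sigma :=
  xget [::] (fun w => W w /\ one_deficient w q).

Definition state_map (W : set (seq Sigma)) (q : Q) : Q :=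
  contracting_state q (excluding_word W q).

(* A single orbit, equal to all of [Q]; in particular [Q] is nonempty. *)
Definition cyclic_permutation (f : Q -> Q) : Prop :=
  exists s : {perm Q}, f =1 s /\ porbits s = [set [set: Q]].

Definition aperiodically_one_contracting : Prop :=
  exists W : set (seq Sigma),
    one_contracting_collection W /\ cyclic_permutation (state_map W).

End Automata.

(* Main.v *)
Require Import Defs.
From mathcomp Require Import classical_sets.
From mathcomp Require Import all_boot fingroup perm.
From mathcomp Require Import zify.

Set Implicit Arguments.
Unset Strict Implicit.
Unset Printing Implicit Defensive.

Local Open Scope nat_scope.

(** If [S] is a nonempty proper subset of [Q], the cyclic map [sigma_W] sends
some [q] outside [S] into [S]. The preimage of [S] under the word excluding [q]
is then strictly larger than [S] and is mapped onto [S]. Iterating, [S] is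
reached from [Q] by at most [n - |S|] words of length at most [n]. To
synchronize, start from a pair of states merged by a single letter:
[n (n - 2) + 1 = (n - 1)^2]. *)

Lemma run_set_cat (Q Sigma : finType) (delta : Q -> Sigma -> Q) (S : {set Q})
    (u v : seq Sigma) :
  run_set delta S (u ++ v) = run_set delta (run_set delta S u) v.
Proof.
rewrite /run_set -imset_comp; apply: eq_imset => q /=.
by rewrite /run foldl_cat.
Qed.

Lemma run_inj (Q Sigma : finType) (delta : Q -> Sigma -> Q) (w : seq Sigma) :
  (forall a, injective (delta^~ a)) -> injective (run delta ^~ w).
Proof.
move=> inj; elim: w => [|a w IHw] p q //= eq_pq.
exact: inj (IHw _ _ eq_pq).
Qed.

(** If every letter acted injectively, so would [w], and its image would have [#|Q|] elements
    instead of missing [q]. *)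
Lemma one_deficient_merging_letter (Q Sigma : finType)
    (delta : Q -> Sigma -> Q) (w : seq Sigma) (q : Q) :
  one_deficient delta w q ->
  exists a x y, x != y /\ delta x a = delta y a.
Proof.
move=> def_w.
have [/existsP[a /injectivePn[x [y neq_xy eq_xy]]]|] :=
  boolP [exists a, ~~ injectiveb (delta^~ a)]; first by exists a, x, y.
rewrite negb_exists => /forallP all_inj.
have inj_w : injective (run delta ^~ w).
  by apply: run_inj => a; apply/injectiveP; have := all_inj a; rewrite negbK.
have := card_imset [set: Q] inj_w.
rewrite -/(run_set delta [set: Q] w) def_w => eq_card.
by have := cardsD1 q [set: Q]; rewrite in_setT eq_card; lia.
Qed.

(** Otherwise the complement of [S] is closed under [s], so the orbit of a point [y] outside [S]
    never meets [S]; but that orbit is all of [Q]. *)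
Lemma porbitT_enters (Q : finType) (s : {perm Q}) (S : {set Q}) :
  porbits s = [set [set: Q]] -> S != set0 -> S != setT ->
  exists2 q, q \notin S & s q \in S.
Proof.
move=> orb_s /set0Pn[x Sx] /eqP S_neqT.
have [y Sy] : exists y, y \notin S.
  apply/existsP; rewrite -negb_forall; apply/forallP => S_all.
  by apply: S_neqT; apply/setP => y; rewrite in_setT S_all.
have [/existsP[q /andP[]]|] := boolP [exists q, (q \notin S) && (s q \in S)].
  by exists q.
rewrite negb_exists => /forallP closed_s.
have : x \in porbit s y.
  have : porbit s y \in porbits s by apply: imset_f.
  by rewrite orb_s => /set1P ->; rewrite in_setT.
case/porbitP=> i def_x; suff : x \notin S by rewrite Sx.
rewrite {x Sx}def_x; elim: i => [|i IHi]; first by rewrite expg0 perm1.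
by have := closed_s ((s ^+ i)%g y); rewrite IHi /= expgSr permM.
Qed.

Lemma excluding_wordP (Q Sigma : finType) (delta : Q -> Sigma -> Q)
    (W : set (seq Sigma)) (q : Q) :
  one_contracting_collection delta W ->
  W (excluding_word delta W q) /\
  one_deficient delta (excluding_word delta W q) q.
Proof.
move=> coll; have [w [Pw _]] := coll q.
exact: (xgetI (P := fun v => W v /\ one_deficient delta v q) [::] Pw).
Qed.

Lemma expanding_word (Q Sigma : finType) (delta : Q -> Sigma -> Q)
    (W : set (seq Sigma)) (S : {set Q}) :
  one_contracting_collection delta W ->
  cyclic_permutation (state_map delta W) -> S != set0 -> S != setT ->
  exists w (T : {set Q}), [/\ W w, run_set delta T w = S & #|S| < #|T|].
Proof.
move=> coll [s [state_s orb_s]] S_neq0 S_neqT.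
have [q Sq] := porbitT_enters orb_s S_neq0 S_neqT.
have [Ww def_w] := excluding_wordP q coll.
rewrite -state_s /state_map /contracting_state.
set w := excluding_word delta W q in Ww def_w *.
case: pickP => [c /cards2P[x [y [neq_xy def_xy]]]|_]; last first.
  (* Were no state to have exactly two preimages, the default value would make [state_map] fix [q],
     contradicting [q \notin S]. *)
  by move=> /= Sq'; rewrite Sq' in Sq.
move=> /= Sc; exists w, [set p | run delta p w \in S].
have run_c z : z \in [set x; y] -> run delta z w = c.
  by rewrite -def_xy inE => /eqP.
have run_x := run_c x (set21 x y); have run_y := run_c y (set22 x y).
(* The only state that [w] misses is [q], which lies outside [S], so each state of [S] has a
   preimage. *)
have onto_S : run_set delta [set p | run delta p w \in S] w = S.
  apply/setP => z; apply/imsetP/idP => [[p]|Sz]; first by rewrite inE => Sp ->.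
  have : z \in run_set delta [set: Q] w.
    by rewrite def_w !inE andbT; apply: contraNneq Sq => <-.
  by case/imsetP=> p _ def_z; exists p => //; rewrite inE -def_z.
split=> //; rewrite -{1}onto_S ltn_neqAle leq_imset_card andbT.
(* Equal cardinals would make [w] injective on the preimage of [S], which contains both [x] and [y],
   merged into [c]. *)
apply: contra neq_xy => /imset_injP inj_w.
by apply/eqP/inj_w; rewrite ?inE ?run_x ?run_y.
Qed.

(** Induction on a strict upper bound [k] of the codimension of [S], since the preimage [T] may
    exceed [S] by more than one state. *)
Lemma reach_set (Q Sigma : finType) (delta : Q -> Sigma -> Q)
    (W : set (seq Sigma)) (S : {set Q}) :
  efficient_collection delta W ->
  cyclic_permutation (state_map delta W) -> S != set0 ->
  exists w, size w <= #|Q| * (#|Q| - #|S|) /\ run_set delta [set: Q] w = S.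
Proof.
move=> [coll eff] cyc; have [k] := ubnP (#|Q| - #|S|).
elim: k S => // k IHk S le_k S_neq0.
have [->|S_neqT] := eqVneq S setT.
  by exists [::]; split=> //; rewrite /run_set imset_id.
have [w [T [Ww run_T lt_ST]]] := expanding_word coll cyc S_neq0 S_neqT.
have le_TQ : #|T| <= #|Q| := max_card _.
have [||v [size_v run_v]] := IHk T; first by lia.
  by rewrite -card_gt0; lia.
exists (v ++ w); split; last by rewrite run_set_cat run_v.
rewrite size_cat; have := eff w Ww.
(* The extra factor [#|Q|] pays for the letters of [w]. *)
have : #|Q| * (#|Q| - #|T|).+1 <= #|Q| * (#|Q| - #|S|).
  by rewrite leq_mul2l; apply/orP; right; lia.
by rewrite mulnS; lia.
Qed.

Lemma ex_shortest_synchronizing (Q Sigma : finType) (delta : Q -> Sigma -> Q)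
    (v : seq Sigma) :
  synchronizing delta v ->
  exists w, shortest_synchronizing delta w /\ size w <= size v.
Proof.
(* There are finitely many words of a given length, so [P] is a boolean predicate and has a least
   witness. *)
pose P m := [exists t : m.-tuple Sigma,
  [exists q, run_set delta [set: Q] t == [set q]]].
have PP u : synchronizing delta u -> P (size u).
  case=> q sync_u; apply/existsP; exists (in_tuple u).
  by apply/existsP; exists q; apply/eqP.
move=> sync_v; case: (ex_minnP (ex_intro P _ (PP v sync_v))) => m.
case/existsP=> t /existsP[q /eqP sync_t] min_m.
exists t; rewrite size_tuple; split; last exact/min_m/PP.
by split=> [|u sync_u]; [exists q | rewrite size_tuple; apply/min_m/PP].
Qed.

Theorem theorem2 (Q Sigma : finType) (delta : Q -> Sigma -> Q)
  (hA : aperiodically_one_contracting delta)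
  (W : set (seq Sigma))
  (hW : efficient_collection delta W)
  (hsigma : cyclic_permutation (state_map delta W)) :
  (exists w : seq Sigma,
     shortest_synchronizing delta w /\ size w <= (#|Q| - 1) ^ 2) /\
  (forall S : {set Q}, S != set0 ->
     exists w : seq Sigma,
       size w <= #|Q| * (#|Q| - #|S|) /\ run_set delta [set: Q] w = S).
Proof.
split=> [|S]; last exact: reach_set hW hsigma.
(* As an orbit, [[set: Q]] is the orbit of some state. *)
have [q0 _] : exists q, q \in [set: Q].
  case: hsigma => s [_ orb_s].
  have : [set: Q] \in porbits s by rewrite orb_s set11.
  by case/imsetP=> q _ _; exists q; rewrite in_setT.
have [_ def_w] := excluding_wordP q0 hW.1.
have [a [x [y [neq_xy eq_xy]]]] := one_deficient_merging_letter def_w.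
have card_xy : #|[set x; y]| = 2 by rewrite cards2 neq_xy.
have [|v [size_v run_v]] := reach_set (S := [set x; y]) hW hsigma.
  by rewrite -card_gt0 card_xy.
have [|w [short_w size_w]] := @ex_shortest_synchronizing _ _ delta (rcons v a).
  exists (delta x a); rewrite -cats1 run_set_cat run_v /run_set.
  by rewrite imsetU1 imset_set1 /run /= -eq_xy setUid.
exists w; split=> //; apply: leq_trans size_w _; rewrite size_rcons.
have := max_card (mem [set x; y]); rewrite card_xy; move: size_v.
(* Two distinct states rule out [#|Q| < 2]; from here on [#|Q|] is [n.+2], and the claim rests on
   [(n + 2) * n < (n + 1) ^ 2]. *)
rewrite card_xy; case: #|Q| => [|[|n]] // size_v _.
by apply: leq_ltn_trans size_v _; rewrite subn1 /= -mulnn; nia.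
Qed.
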